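(* Let $G$ be a countable abelian group such that $2G$ is infinite, and let $\Phi$ be a Følner sequence in $G$ that is not quasi-invariant with respect to doubling. Then there exists a set $A\subset G$ with $\overline{\mathrm{d}}_\Phi(A)=1$ such that $t+B+B\not\subset A$ for any infinite set $B\subset G$ and any element $t\in G$.
   Context: For $g\in G$, $2g:=g+g$; $2G=\{2g: g\in G\}$. For $C\subset G$, $C/2:=\{g\in G: 2g\in C\}$. A Følner sequence in $G$ is a sequence $\Phi=(\Phi_N)_{N\in\mathbb{N}}$ of (nonempty) finite subsets of $G$ with $\lim_{N\to\infty}\frac{|\Phi_N\cap(g+\Phi_N)|}{|\Phi_N|}=1$ for every $g\in G$. $\overline{\mathrm{d}}_\Phi(A)=\limsup_{N\to\infty}\frac{|A\cap\Phi_N|}{|\Phi_N|}$. The doubling ratio of $\Phi$ is $\alpha_\Phi=\liminf_{N\to\infty}\frac{|(\Phi_N/2)\cap\Phi_N|}{|\Phi_N|}$; $\Phi$ is quasi-invariant with respect to doubling if $\alpha_\Phi>0$. $t+B+B=\{t+b_1+b_2: b_1,b_2\in B\}$ (with $b_1=b_2$ allowed). *)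

(* Defs.v *)
From mathcomp Require Import all_boot all_order all_algebra finmap.
From mathcomp Require Import all_classical all_reals all_analysis.

Set Implicit Arguments.
Unset Strict Implicit.
Unset Printing Implicit Defensive.

Import Order.TTheory GRing.Theory Num.Theory numFieldNormedType.Exports.

Local Open Scope classical_set_scope.
Local Open Scope ring_scope.

Definition translated_set {G : zmodType} (g : G) (C : set G) : set G :=
  [set g + x | x in C].

Definition doubled_set {G : zmodType} (C : set G) : set G :=
  [set g + g | g in C].

Definition halved_set {G : zmodType} (C : set G) : set G :=
  [set g | C (g + g)].

(* |A `&` F| / |F| *)
Definition proportion (R : realType) {G : zmodType} (A : set G)
    (F : {fset G}) : R :=
  #|` [fset x in F | x \in A]%fset|%:R / #|` F|%:R.

Definition folner_sequence (R : realType) {G : zmodType}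
    (Phi : nat -> {fset G}) : Prop :=
  (forall N, Phi N != fset0) /\
  (forall g : G,
     (fun N => proportion R (translated_set g [set` Phi N]) (Phi N)) @ \oo
       --> (1 : R)).

(* The limsup and liminf are taken in \bar R, where they exist with no
   boundedness condition; here all proportions lie in [0, 1]. *)
Definition upper_density (R : realType) {G : zmodType}
    (Phi : nat -> {fset G}) (A : set G) : \bar R :=
  limn_esup (fun N => (proportion R A (Phi N))%:E).

Definition doubling_ratio (R : realType) {G : zmodType}
    (Phi : nat -> {fset G}) : \bar R :=
  limn_einf (fun N => (proportion R (halved_set [set` Phi N]) (Phi N))%:E).

Definition doubling_quasi_invariant (R : realType) {G : zmodType}
    (Phi : nat -> {fset G}) : Prop :=
  (0 < doubling_ratio R Phi)%E.

Definition shifted_sumset {G : zmodType} (t : G) (B : set G) : set G :=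
  [set t + b1 + b2 | b1 in B & b2 in B].

(* Main.v *)
Require Import Defs.
From mathcomp Require Import all_boot all_order all_algebra finmap.
From mathcomp Require Import all_classical all_reals all_analysis.

Set Implicit Arguments.
Unset Strict Implicit.
Unset Printing Implicit Defensive.

Import Order.TTheory GRing.Theory Num.Theory numFieldNormedType.Exports.

Local Open Scope classical_set_scope.
Local Open Scope ring_scope.

(** The set A is a union of finite pieces E_k, each filling all but a fraction
    1/(k+1) of some Phi_N with N >= k; this alone makes the upper density 1.

    Suppose t + B + B lies in A.  Fix b0 in B.  For b in B put x = t + b0 + b,
    y = t + b + b and s = - t - 2 b0.  Then x and y lie in A and y = 2x + s,
    where s does not depend on b.  As B is infinite, x can be taken in a piece
    E_k with k arbitrarily large.  So it suffices that, for every s, the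
    equation y = 2x + s has no solution with x in E_k and y in A once k is at
    least the code of s in a fixed enumeration of G.  At stage k only the
    finite set S of shifts of code at most k and the finite union P of the
    earlier pieces matter, and Phi_N must be freed of the solutions with
    - x in E_k and y in P, by deleting the x with 2x in P - S;
    - x in P and y in E_k, by deleting the y with 2y in 2(2P + S),
      a set that contains 2P + S;
    - both x and y in E_k.
    The first two deletions have density 0 because every fibre of doubling has
    density 0 (density_zero_double_fiber), which is where 2G infinite enters.

    In the third case, deleting the x of Phi_N with 2x + s in Phi_N would be
    the obvious choice, but the failure of quasi-invariance only controls s = 0
    and, by translation, s in 2G.  When s is not in 2G and doubling has
    infinite kernel, few y may be the image of many x, so the Folner property
    does not transfer this control to s.  The way out is to choose which end of the pair to delete.  If
    y - s = 2x lies in Phi_N, then x is in (Phi_N)/2, whose proportion is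
    arbitrarily small for suitable N: delete x.  Otherwise y is in Phi_N and
    y - s is not, which by the Folner property holds on a set of density 0:
    delete y.  The result is sparse_stage. *)

(** Writing cardinals as sums of indicators turns the counting arguments
    below into termwise comparisons. *)
Lemma proportionE (R : realType) (G : zmodType) (A : set G) (F : {fset G}) :
  proportion R A F = (\sum_(x <- F) (x \in A)%:R) / #|` F|%:R.
Proof.
rewrite /proportion card_fset_sum1 natr_sum big_fset //= big_mkcond /=.
by congr (_ / _); apply: eq_bigr => x _; case: (x \in A).
Qed.

Lemma proportion_ge0 (R : realType) (G : zmodType) (A : set G) (F : {fset G}) :
  0 <= proportion R A F.
Proof. by rewrite divr_ge0. Qed.

Lemma proportion_le (R : realType) (G : zmodType) (A B : set G) (F : {fset G}) :
  {in F, forall x, A x -> B x} -> proportion R A F <= proportion R B F.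
Proof.
move=> AB; rewrite ler_wpM2r ?invr_ge0// ler_nat fsubset_leq_card//.
apply/fsubsetP => x; rewrite !inE => /andP[xF /set_mem xA].
by rewrite xF; apply/mem_set/AB.
Qed.

Lemma proportion_setU (R : realType) (G : zmodType) (A B : set G)
    (F : {fset G}) :
  proportion R (A `|` B) F <= proportion R A F + proportion R B F.
Proof.
rewrite !proportionE -mulrDl -big_split /= ler_wpM2r ?invr_ge0//.
by apply: ler_sum => x _; rewrite in_setU -natrD ler_nat; do 2!case: (_ \in _).
Qed.

Lemma proportion_setC (R : realType) (G : zmodType) (A : set G)
    (F : {fset G}) :
  F != fset0 -> proportion R (~` A) F = 1 - proportion R A F.
Proof.
move=> F0; have c0 : #|` F|%:R != 0 :> R by rewrite pnatr_eq0 cardfs_eq0.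
apply/eqP; rewrite -subr_eq opprK !proportionE -mulrDl -big_split /=.
rewrite (eq_bigr (fun=> 1%:R)) => [|x _].
  by rewrite -natr_sum -card_fset_sum1 divff.
by rewrite in_setC -natrD; case: (_ \in _).
Qed.

Lemma proportion_le1 (R : realType) (G : zmodType) (A : set G) (F : {fset G}) :
  F != fset0 -> proportion R A F <= 1.
Proof.
by move=> F0; rewrite -subr_ge0 -proportion_setC// proportion_ge0.
Qed.

(** Pairwise disjoint sets: each point of F is counted at most once.
    Disjointness is in the form of injectivity of the index. *)
Lemma sum_proportion_le1 (R : realType) (G : zmodType) (I : choiceType)
    (s : {fset I}) (D : I -> set G) (F : {fset G}) :
  F != fset0 -> (forall i j x, D i x -> D j x -> i = j) ->
  \sum_(i <- s) proportion R (D i) F <= 1.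
Proof.
move=> F0 Dinj; have c0 : 0 < #|` F|%:R :> R by rewrite ltr0n cardfs_gt0.
under eq_bigr do rewrite proportionE.
rewrite -mulr_suml ler_pdivrMr// mul1r exchange_big /=.
rewrite [leRHS](_ : _ = \sum_(x <- F) 1); last first.
  by rewrite card_fset_sum1 natr_sum.
apply: ler_sum => x _; have [[i [si Dix]]|no] := pselect (exists i, i \in s /\ D i x).
  rewrite (big_fsetD1 i)//= big_seq big1 ?addr0; first by case: (_ \in _).
  move=> j; rewrite !inE => /andP[/eqP ji _].
  by case: (boolP (x \in D j)) => // /set_mem Djx; case: ji; apply: Dinj Djx Dix.
rewrite big_seq big1// => i si.
by case: (boolP (x \in D i)) => // /set_mem Dix; case: no; exists i.
Qed.

(** Translation by g injects the points of A that stay in F into A + g. *)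
Lemma proportion_shift (R : realType) (G : zmodType) (A : set G) (g : G)
    (F : {fset G}) :
  proportion R A F <= proportion R [set y | A (y - g)] F
                      + proportion R [set x | x + g \notin F] F.
Proof.
apply: le_trans (_ : proportion R ([set x | A x /\ x + g \in F] `|`
  [set x | x + g \notin F]) F <= _).
  apply: proportion_le => x xF Ax /=.
  by have [|] := boolP (x + g \in F); [left | right].
apply: le_trans (proportion_setU _ _ _ _) _.
rewrite lerD2r ler_wpM2r ?invr_ge0// ler_nat.
have card_shift (E : {fset G}) : #|` [fset (g + x)%R | x in E]%fset| = #|` E|.
  by rewrite card_imfset//; exact: addrI.
rewrite -card_shift fsubset_leq_card//.
apply/fsubsetP => _ /imfsetP[x + ->]; rewrite !inE => /andP[xF /set_mem[Ax xgF]].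
by rewrite addrC xgF; apply/mem_set; rewrite /= addrK.
Qed.

(** The sets may vary with N, since those deleted at a stage depend on
    Phi_N itself. *)
Definition density_zero (R : realType) (G : zmodType) (Phi : nat -> {fset G})
    (X : nat -> set G) :=
  (fun N => proportion R (X N) (Phi N)) @ \oo --> (0 : R).

Lemma density_zero_sub (R : realType) (G : zmodType) (Phi : nat -> {fset G})
    (X Y : nat -> set G) :
  (forall N x, X N x -> Y N x) -> density_zero R Phi Y ->
  density_zero R Phi X.
Proof.
move=> XY Y0; apply: (squeeze_cvgr _ (cvg_cst 0) Y0); apply: nearW => N.
by rewrite proportion_ge0; apply: proportion_le => x _; apply: XY.
Qed.

Lemma density_zeroU (R : realType) (G : zmodType) (Phi : nat -> {fset G})
    (X Y : nat -> set G) :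
  density_zero R Phi X -> density_zero R Phi Y ->
  density_zero R Phi (fun N => X N `|` Y N).
Proof.
move=> X0 Y0; have XY0 :
    (fun N => proportion R (X N) (Phi N) + proportion R (Y N) (Phi N)) @ \oo --> (0 : R) by rewrite -[0]addr0; exact: cvgD X0 Y0.
apply: (squeeze_cvgr _ (cvg_cst 0) XY0); apply: nearW => N.
by rewrite proportion_ge0 proportion_setU.
Qed.

Lemma density_zero_bigU (R : realType) (G : zmodType) (Phi : nat -> {fset G})
    (I : eqType) (s : seq I) (X : I -> nat -> set G) :
  (forall i, density_zero R Phi (X i)) ->
  density_zero R Phi (fun N => [set x | exists2 i, i \in s & X i N x]).
Proof.
move=> X0; elim: s => [|i s IHs].
  rewrite /density_zero (_ : (fun _ => _) = cst 0); first exact: cvg_cst.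
  apply/funext => N; apply/eqP; rewrite eq_le proportion_ge0 andbT.
  rewrite proportionE big1 ?mul0r// => x _.
  by case: (boolP (x \in _)) => // /set_mem[].
apply: density_zero_sub (density_zeroU (X0 i) IHs) => N x [j].
by rewrite inE => /predU1P[-> ?|]; [left | right; exists j].
Qed.

Lemma density_zero_shift (R : realType) (G : zmodType) (Phi : nat -> {fset G})
    (g : G) :
  folner_sequence R Phi ->
  density_zero R Phi (fun N => [set x | x + g \notin Phi N]).
Proof.
move=> [Phi0 Phi1]; have tr0 :
    (fun N => 1 - proportion R (translated_set (- g) [set` Phi N]) (Phi N)) @ \oo --> (0 : R) by rewrite -(subrr 1); exact: cvgB (cvg_cst _) (Phi1 _).
apply: (squeeze_cvgr _ (cvg_cst 0) tr0); apply: nearW => N.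
rewrite proportion_ge0 -[leRHS]proportion_setC//.
apply: proportion_le => x _ /= /negP xg [y /= yPhi] xE; apply: xg.
by rewrite -xE addrC addNKr.
Qed.

(** Shifting {x | 2x = c} by h, where 2h = y, gives {x | 2x = c + y}.  As 2G is
    infinite there are as many of these pairwise disjoint shifts as desired; by
    the Folner property they all have the same proportion up to o(1), and the
    proportions of M disjoint sets add up to at most 1. *)
Lemma density_zero_double_fiber (R : realType) (G : zmodType)
    (Phi : nat -> {fset G}) (c : G) :
  infinite_set (doubled_set [set: G]) -> folner_sequence R Phi ->
  density_zero R Phi (fun=> [set x | x + x = c]).
Proof.
move=> G2 folPhi; apply/cvgr0Pnorm_lt => e e0.
(* With more than 2/e shifts, p < e follows from #|B| * p < 1 + 1: one unit
   bounds the disjoint fibres, the other the vanishing loss at the boundary. *)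
have [B BG Bbig] := infinite_set_fset (Num.truncn (2 / e)).+1 G2.
pose h (y : G) := xget 0 [set g | g + g = y].
have hB y : y \in B -> h y + h y = y.
  by move=> /BG[g _ gy]; rewrite /h; apply: (@xgetPex _ 0 [set g | g + g = y]); exists g.
have shift0 : (fun N => \sum_(y <- B)
    proportion R [set x | x + h y \notin Phi N] (Phi N)) @ \oo --> (0 : R).
  have := @cvg_big _ _ _ (0 : R) predT (@add_continuous R^o) nat \oo B
    (fun y N => proportion R [set x | x + h y \notin Phi N] (Phi N)) (fun=> 0) _
    (fun y _ => density_zero_shift (h y) folPhi).
  by rewrite big1//; apply.
near=> N; rewrite ger0_norm ?proportion_ge0//.
set p := proportion _ _ _.
have M0 : 0 < #|` B|%:R :> R by rewrite ltr0n (leq_trans _ Bbig).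
have Mp : #|` B|%:R * p < 2.
  apply: (@le_lt_trans _ _ (\sum_(y <- B)
    (proportion R [set x | x + x = c + y] (Phi N) +
     proportion R [set x | x + h y \notin Phi N] (Phi N)))).
    rewrite mulr_natl card_fset_sum1 -sumrMnr.
    rewrite big_seq [leRHS]big_seq; apply: ler_sum => y yB; rewrite mulr1n.
    apply: le_trans (proportion_shift _ _ (h y) _) _.
    rewrite lerD2r; apply: proportion_le => x _ /= <-.
    by rewrite addrACA -opprD hB// subrK.
  rewrite big_split /= -[ltRHS]/(1 + 1) ler_ltD//.
    by apply: sum_proportion_le1 => [|i j x /= -> /addrI//]; case: folPhi.
  by near: N; apply: cvgr_lt shift0 _ ltr01.
rewrite -(ltr_pM2l M0); apply: lt_le_trans Mp _.
rewrite -ler_pdivrMr//; apply: ltW; apply: lt_le_trans (truncnS_gt _) _.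
by rewrite ler_nat.
Unshelve. all: by end_near. Qed.

Lemma limn_esup_ub (R : realType) (u : (\bar R)^nat) (c : \bar R) (n : nat) :
  (forall N, (n <= N)%N -> (u N <= c)%E) -> (limn_esup u <= c)%E.
Proof.
move=> uc; apply: le_trans (_ : ereal_sup [set u N | N in [set N | (n <= N)%N]] <= _)%E.
  by apply: ereal_inf_lbound; exists [set N | (n <= N)%N] => //; exists n.
by apply: ge_ereal_sup => _ [N nN <-]; apply: uc.
Qed.

Lemma limn_esup_lb (R : realType) (u : (\bar R)^nat) (c : \bar R) :
  (forall n, exists2 N, (n <= N)%N & (c <= u N)%E) -> (c <= limn_esup u)%E.
Proof.
move=> uc; apply: le_ereal_inf_tmp => _ [V [n _ nV] <-].
have [N nN cu] := uc n; apply: le_ereal_sup_tmp; exists (u N) => //.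
by exists N => //; apply: nV.
Qed.

Lemma small_halved_proportion (R : realType) (G : zmodType)
    (Phi : nat -> {fset G}) (e : R) (n : nat) :
  ~ doubling_quasi_invariant R Phi -> 0 < e ->
  exists2 N, (n <= N)%N & proportion R (halved_set [set` Phi N]) (Phi N) < e.
Proof.
move=> nq e0; apply: contrapT => no; apply: nq.
rewrite /doubling_quasi_invariant /doubling_ratio /limn_einf.
apply: lt_le_trans (_ : e%:E <= _)%E; first by rewrite lte_fin.
rewrite leeNr; apply: (@limn_esup_ub _ _ _ n) => N nN /=.
rewrite !lee_fin lerN2 leNgt; apply/negP => lt_e; apply: no.
by exists N.
Qed.

(** The finite sets S and P stand for the shifts to be treated and for the
    pieces already built; the three last clauses exclude y = 2x + s within the
    new piece, from the new piece to P, and from P to the new piece. *)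
Lemma sparse_stage (R : realType) (G : zmodType)
    (h2G : infinite_set (doubled_set [set: G]))
    (Phi : nat -> {fset G}) (hPhi : folner_sequence R Phi)
    (hdbl : ~ doubling_quasi_invariant R Phi)
    (S P : seq G) (e : R) (n : nat) :
  0 < e ->
  exists NE : nat * {fset G},
    [/\ (n <= NE.1)%N,
        1 - e <= proportion R [set` NE.2] (Phi NE.1),
        {in S & NE.2, forall s x, x + x + s \notin NE.2},
        {in S & NE.2, forall s x, x + x + s \notin P} &
        {in S & P, forall s x, x + x + s \notin NE.2}].
Proof.
move=> e0.
pose escape s N : set G := [set y | y + - s \notin Phi N].
pose backward z (N : nat) : set G := [set x | x + x = z].
(* Deleting the whole fibre of 2z instead of z alone covers finite sets by
   the same density statement. *)
pose forward z (N : nat) : set G := [set y | y + y = z + z].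
pose bad N := [set x | exists2 s, s \in S & escape s N x] `|`
  [set x | exists2 z, z \in [seq p - s | p <- P, s <- S] & backward z N x] `|`
  [set x | exists2 z, z \in [seq p + p + s | p <- P, s <- S] & forward z N x].
have bad0 : density_zero R Phi bad.
  apply: density_zeroU; first apply: density_zeroU.
  - by apply: density_zero_bigU => s; apply: density_zero_shift.
  - by apply: density_zero_bigU => z; apply: density_zero_double_fiber.
  - by apply: density_zero_bigU => z; apply: density_zero_double_fiber.
have e20 : 0 < e / 2 by rewrite divr_gt0.
have [m _ bad_small] := cvgr_lt 0 bad0 _ e20.
have [N] := small_halved_proportion (maxn n m) hdbl e20.
rewrite geq_max => /andP[nN mN] half_small.
pose X := halved_set [set` Phi N] `|` bad N.
exists (N, [fset x in Phi N | x \in ~` X]%fset); split => //=.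
- have X_small : proportion R X (Phi N) <= e.
    apply: le_trans (proportion_setU _ _ _ _) _.
    by rewrite [leRHS]splitr lerD// ltW//; apply: bad_small.
  apply: le_trans (_ : proportion R (~` X) (Phi N) <= _).
    by rewrite proportion_setC ?lerB//; case: hPhi.
  by apply: proportion_le => x xN Xx; rewrite /= !inE xN; apply/mem_set.
- move=> s x sS; rewrite !inE => /andP[xN /set_mem xX].
  apply/negP => /andP[yN /set_mem yX].
  (* Here x + x = y - s: either it is in Phi N and x was deleted, or it is
     not and y was deleted. *)
  have [/= x2N|x2N] := boolP (x + x \in Phi N); first by apply: xX; left.
  by apply: yX; right; left; left; exists s => //; rewrite /escape /= addrK.
- move=> s x sS; rewrite !inE => /andP[xN /set_mem xX].
  apply/negP => yP; apply: xX; right; left; right.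
  by exists (x + x + s - s); [apply: allpairs_f | rewrite /backward /= addrK].
- move=> s x sS xP; rewrite !inE; apply/negP => /andP[_ /set_mem]; apply.
  by right; right; exists (x + x + s) => //; apply: allpairs_f.
Qed.

Theorem proposition5p4 (R : realType) (G : zmodType)
    (hG : countable [set: G])
    (h2G : infinite_set (doubled_set [set: G]))
    (Phi : nat -> {fset G})
    (hPhi : folner_sequence R Phi)
    (hdbl : ~ doubling_quasi_invariant R Phi) :
  exists A : set G,
    upper_density R Phi A = 1%E /\
    forall (B : set G) (t : G),
      infinite_set B -> ~ (shifted_sumset t B `<=` A).
Proof.
have /countable_injP[code code_inj] := hG.
pose decode k := xget (0 : G) [set g | code g = k].
have codeK g : decode (code g) = g.
  apply: code_inj; rewrite ?inE//.
  by apply: (@xgetPex _ 0 [set h | code h = code g]); exists g.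
pose shifts k := [seq decode i | i <- iota 0 k.+1].
have in_shifts g k : (code g <= k)%N -> g \in shifts k.
  by move=> gk; rewrite -[g]codeK map_f// mem_iota.
have inv_gt0 k : 0 < k.+1%:R^-1 :> R by rewrite invr_gt0.
have [stage stageP] := choice (fun kP : nat * {fset G} =>
  sparse_stage h2G hPhi hdbl (shifts kP.1) kP.2 kP.1 (inv_gt0 kP.1)).
pose past := fix past k := if k is k'.+1
  then (past k' `|` (stage (k', past k')).2)%fset else fset0.
pose piece k := (stage (k, past k)).2.
have pieceP j k x : (j < k)%N -> x \in piece j -> x \in past k.
  elim: k => // k IHk; rewrite ltnS leq_eqVlt => /predU1P[->|jk] xj /=.
    by rewrite inE; apply/orP; right.
  by rewrite inE IHk.
exists [set x | exists k, x \in piece k]; split.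
  apply/eqP; rewrite eq_le; apply/andP; split.
    apply: (@limn_esup_ub _ _ _ 0) => N _.
    by rewrite lee_fin proportion_le1//; case: hPhi.
  apply/lee_subgt0Pr => e e0; apply: limn_esup_lb => n.
  pose k := maxn n (Num.truncn e^-1).
  have /= [kN dense _ _ _] := stageP (k, past k).
  exists (stage (k, past k)).1; first exact: leq_trans (leq_maxl _ _) kN.
  rewrite lee_fin; apply: le_trans (_ : 1 - k.+1%:R^-1 <= _).
    rewrite lerB// -[leRHS]invrK lef_pV2 ?posrE ?invr_gt0//.
    apply: ltW; apply: lt_le_trans (truncnS_gt _) _.
    by rewrite ler_nat ltnS leq_maxr.
  by apply: le_trans dense _; apply: proportion_le => x _ xk; exists k.
move=> B t Binf sub.
have [b0 Bb0] : B !=set0 by apply: infinite_setN0.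
pose s := - t - (b0 + b0).
(* The pieces before the code of s cover finitely many x, hence miss some b. *)
pose early := \bigcup_(k < code s) [set` piece k].
have earlyF : finite_set early by apply: bigcup_finite.
have [b [Bb late]] : exists b, B b /\ ~ early (t + b0 + b).
  apply: contrapT => no; apply: Binf.
  apply: (sub_finite_set (B := [set x - (t + b0) | x in early])).
    2: exact: finite_image.
  move=> b Bb; exists (t + b0 + b); last by rewrite addrC addKr.
  by apply: contrapT => nearly; apply: no; exists b.
have [k xk] : exists k, t + b0 + b \in piece k by apply: sub; exists b0 => //; exists b.
have [j yj] : exists j, t + b + b \in piece j by apply: sub; exists b => //; exists b.
have ks : (code s <= k)%N by rewrite leqNgt; apply/negP => kl; apply: late; exists k.
have yE : t + b + b = (t + b0 + b) + (t + b0 + b) + s.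
  rewrite -[RHS]addrA.
  have <- : b - b0 = t + b0 + b + s.
    by rewrite /s -opprD addrA [t + b0 + b]addrC opprD addrA addrK.
  by rewrite [t + b0 + b]addrAC -[RHS]addrA [b0 + _]addrC subrK.
rewrite yE in yj; case: (ltngtP j k) => [jk|kj|jk].
- have [_ _ _ /(_ s _ (in_shifts _ _ ks) xk)/negP + _] := stageP (k, past k).
  by apply; apply: pieceP yj.
- have [_ _ _ _] := stageP (j, past j).
  move=> /(_ s _ (in_shifts _ _ (leq_trans ks (ltnW kj))) (pieceP _ _ _ kj xk)).
  by rewrite yj.
- have [_ _ /(_ s _ (in_shifts _ _ ks) xk) + _ _] := stageP (k, past k).
  by rewrite -jk yj.
Qed.
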